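(* Let $\mathbf w=(w_1,\ldots,w_L)^\top$ be a probability vector and $\bar{\mathbf p}=(\bar p_1,\ldots,\bar p_L)^\top>\mathbf 0$. The maximum problem $$\text{(I)}\qquad \max_{\mathbf 0\le\mathbf p\le\bar{\mathbf p}}\ \sum_{l=1}^L w_l\log(1+\gamma_l(\mathbf p))$$ is equivalent to the maximum problem $$\text{(II)}\qquad \text{maximize } \sum_{l=1}^L w_l\log(1+\gamma_l)\quad\text{subject to } \boldsymbol\gamma=(\gamma_1,\ldots,\gamma_L)^\top\in\mathbb R_+^L,\ \ \rho\left(\mathrm{diag}(\boldsymbol\gamma)\left(F+\tfrac1{\bar p_l}\mathbf v\mathbf e_l^\top\right)\right)\le1\ \ \forall\, l\in\{1,\ldots,L\}.$$ That is, the two maxima are equal, and a vector $\boldsymbol\gamma^\star\ge\mathbf 0$ is a maximal solution of (II) if and only if $\boldsymbol\gamma^\star\in\Gamma$ and $P(\boldsymbol\gamma^\star)$ is a maximal solution $\mathbf p^\star$ of (I). In particular, any maximal solution $\boldsymbol\gamma^\star$ of (II) satisfies the equality $\rho\left(\mathrm{diag}(\boldsymbol\gamma^\star)\left(F+\tfrac1{\bar p_l}\mathbf v\mathbf e_l^\top\right)\right)=1$ for some $l\in\{1,\ldots,L\}$.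
   Context: $F=[f_{ij}]\in\mathbb R^{L\times L}$ is a fixed matrix with zero diagonal entries and positive off-diagonal entries, and $\mathbf v=(v_1,\ldots,v_L)^\top$ is a fixed vector with all entries positive. The map $\gamma:\mathbb R_+^L\to\mathbb R_+^L$ is $\gamma_l(\mathbf p)=\dfrac{p_l}{(F\mathbf p)_l+v_l}$. Let $\Gamma=\{\boldsymbol\gamma\ge\mathbf 0:\ \rho(\mathrm{diag}(\boldsymbol\gamma)F)<1\}$ and, for $\boldsymbol\gamma\in\Gamma$, $P(\boldsymbol\gamma)=(I-\mathrm{diag}(\boldsymbol\gamma)F)^{-1}\mathrm{diag}(\boldsymbol\gamma)\mathbf v$. Here $\rho$ is the spectral radius, $\mathrm{diag}(\mathbf y)$ is the diagonal matrix with diagonal $\mathbf y$, $\mathbf e_l$ is the $l$-th standard basis vector, inequalities between vectors are entrywise, and a probability vector is a nonnegative vector with entries summing to $1$. A maximal solution is a feasible point attaining the maximum. *)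

(* Defs.v *)
From HB Require Import structures.
From mathcomp Require Import all_boot all_order all_algebra.
From mathcomp Require Import complex.
From mathcomp Require Import all_classical all_reals all_analysis.

Set Implicit Arguments.
Unset Strict Implicit.
Unset Printing Implicit Defensive.

Import Order.TTheory GRing.Theory Num.Theory.

Local Open Scope classical_set_scope.
Local Open Scope ring_scope.

Definition le_vec (R : realType) (L : nat) (x y : 'cV[R]_L) : Prop :=
  forall l, x l 0 <= y l 0.

Definition diag (R : realType) (L : nat) (y : 'cV[R]_L) : 'M[R]_L :=
  diag_mx y^T.

Definition basis_vec (R : realType) (L : nat) (l : 'I_L) : 'cV[R]_L :=
  delta_mx l 0.

Definition prob_vec (R : realType) (L : nat) (w : 'cV[R]_L) : Prop :=
  le_vec 0 w /\ \sum_l w l 0 = 1.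

(* The eigenvalues are taken in R[i].  For 0 < L the set below is finite and
   nonempty, so that its supremum is a maximum; for L = 0 it is empty and the
   value is 0. *)
Definition spectral_radius (R : realType) (L : nat) (A : 'M[R]_L) : R :=
  sup [set ComplexField.Normc.normc z
      | z in [set z : R[i] | eigenvalue (map_mx (real_complex R) A) z]].

Definition gamma_map (R : realType) (L : nat) (F : 'M[R]_L) (v : 'cV[R]_L)
    (p : 'cV[R]_L) : 'cV[R]_L :=
  \col_l (p l 0 / ((F *m p) l 0 + v l 0)).

Definition Gamma_set (R : realType) (L : nat) (F : 'M[R]_L) : set 'cV[R]_L :=
  [set g | le_vec 0 g /\ spectral_radius (diag g *m F) < 1].

Definition power (R : realType) (L : nat) (F : 'M[R]_L) (v : 'cV[R]_L)
    (g : 'cV[R]_L) : 'cV[R]_L :=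
  invmx (1%:M - diag g *m F) *m (diag g *m v).

Definition sum_rate (R : realType) (L : nat) (w g : 'cV[R]_L) : R :=
  \sum_l w l 0 * ln (1 + g l 0).

Definition constraint_mx (R : realType) (L : nat) (F : 'M[R]_L)
    (v pbar : 'cV[R]_L) (l : 'I_L) : 'M[R]_L :=
  F + (pbar l 0)^-1 *: (v *m (basis_vec R l)^T).

Definition feasible_I (R : realType) (L : nat) (pbar : 'cV[R]_L) :
    set 'cV[R]_L :=
  [set p | le_vec 0 p /\ le_vec p pbar].

Definition objective_I (R : realType) (L : nat) (F : 'M[R]_L)
    (v w p : 'cV[R]_L) : R :=
  sum_rate w (gamma_map F v p).

Definition feasible_II (R : realType) (L : nat) (F : 'M[R]_L)
    (v pbar : 'cV[R]_L) : set 'cV[R]_L :=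
  [set g | le_vec 0 g /\
     forall l, spectral_radius (diag g *m constraint_mx F v pbar l) <= 1].

Definition is_max (R : realType) (A : set R) (M : R) : Prop :=
  A M /\ ubound A M.

Definition maximal_solution (R : realType) (T : Type) (D : set T) (f : T -> R)
    (x : T) : Prop :=
  D x /\ forall y, D y -> f y <= f x.

(* Main.v *)
Require Import Defs.
From HB Require Import structures.
From mathcomp Require Import all_boot all_order all_algebra.
From mathcomp Require Import complex.
From mathcomp Require Import ring lra.
From mathcomp Require Import all_classical all_reals all_analysis.

Set Implicit Arguments.
Unset Strict Implicit.
Unset Printing Implicit Defensive.

Import Order.TTheory GRing.Theory Num.Theory.
Import numFieldNormedType.Exports.

Local Open Scope classical_set_scope.
Local Open Scope ring_scope.

(** The power vector p and the ratio vector g = gamma(p) determine each other: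
    g = gamma(p) means p_i = g_i ((F p)_i + v_i), that is
    (I - diag(g) F) p = diag(g) v, and for rho(diag(g) F) < 1 this system has
    the unique solution P(g), which is nonnegative ([gamma_mapK], [powerK]).
    So the two problems are equivalent, maximisers included, once the
    constraints of (II) are seen to describe the set of those g with
    rho(diag(g) F) < 1 and P(g) <= pbar ([feasible_IIP]).

    Write B_l = diag(g) (F + v e_l^T / pbar_l). Then
    (B_l p)_i = g_i ((F p)_i + v_i p_l / pbar_l), so for p = P(g) one has
    B_l p <= p exactly when p_l <= pbar_l. If p_l <= pbar_l, a subinvariant
    vector bounds the spectral radius, whence rho(B_l) <= 1. If p_l > pbar_l,
    then B_l p >= (1 + e) p for some e > 0, whence rho(B_l) > 1. That
    rho(B_l) <= 1 forces rho(diag(g) F) < 1 as soon as g_l > 0 is a strict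
    monotonicity: take x > 0 with B_l x < (1 + e) x. As the off-diagonal
    entries of F are positive, the l-th row bounds every x_i by a multiple of
    x_l that does not depend on e, so dropping the rank one term of B_l gains
    a fixed proportion of x_i, which exceeds e x_i for small e. Rows with
    g_i = 0 vanish and are carried along separately.

    The facts of Perron-Frobenius theory used are that A x <= c x, with x > 0
    or at least positive at the nonzero rows of A, gives rho(A) <= c
    ([spectral_radius_le]), and the converse that rho(A) < c gives some x > 0
    with A x < c x ([exists_strict_subinvariant]). For the converse, the
    infimum r of the admissible c is an eigenvalue: otherwise (r - A)^-1
    exists, is nonnegative as a limit of nonnegative inverses, and sends the
    all-one vector to a vector which shows that slightly smaller values are
    admissible as well.

    A maximum of (I) exists by compactness of the box. If every constraint of
    (II) were slack at a maximiser g, then (1 + d) g would be feasible for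
    some d > 0 and would have a larger objective, since w_l > 0 and g_l > 0
    for some l at a maximiser. *)

(** * Spectral radius of nonnegative matrices *)

Section PerronFrobenius.

Variables (R : realType) (n : nat).
Implicit Types (A : 'M[R]_n) (x y p : 'cV[R]_n) (c t : R) (z : R[i]).

Lemma mulmx_cV m (A : 'M[R]_(m, n)) x i :
  (A *m x) i 0 = \sum_j A i j * x j 0.
Proof. by rewrite mxE. Qed.

(** Replaces minima of finitely many positive ratios: one factor d serves all
    the indices, including the case where no index satisfies P. *)
Lemma uniform_domination (P : pred 'I_n) (a b : 'I_n -> R) :
  (forall i, P i -> 0 < b i) ->
  exists2 d, 0 < d & forall i, P i -> d * a i <= b i.
Proof.
move=> b0; pose s := 1 + \sum_i `|a i / b i|.
have s1 : 1 <= s by rewrite lerDl sumr_ge0.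
have s0 : 0 < s by exact: lt_le_trans s1.
exists s^-1; first by rewrite invr_gt0.
move=> i Pi; rewrite mulrC ler_pdivrMr// mulrC -ler_pdivrMr ?b0//.
rewrite (le_trans (ler_norm _))// /s (bigD1 i)//= addrCA lerDl.
by rewrite addr_ge0// sumr_ge0.
Qed.

Lemma mulmx_monotone A x y : (forall i j, 0 <= A i j) ->
  le_vec x y -> le_vec (A *m x) (A *m y).
Proof.
move=> A0 xy i; rewrite !mulmx_cV; apply: ler_sum => j _.
by rewrite ler_wpM2l.
Qed.

Lemma normc_ge0 z : 0 <= ComplexField.Normc.normc z.
Proof. by case: z => a b /=; rewrite sqrtr_ge0. Qed.

Lemma normc_real t : ComplexField.Normc.normc t%:C%C = `|t|.
Proof. by rewrite /= expr0n addr0 sqrtr_sqr. Qed.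

Lemma normc_sum (I : finType) (f : I -> R[i]) :
  ComplexField.Normc.normc (\sum_i f i) <= \sum_i ComplexField.Normc.normc (f i).
Proof.
elim/big_ind2 : _ => [||//]; first by rewrite ComplexField.Normc.normc0.
move=> x1 y1 x2 y2 h1 h2.
by rewrite (le_trans (le_normcD _ _))// lerD.
Qed.

(** Eigenvalues are those of left eigenvectors u, so pairing |u| with x gives
    |z| |u| x <= |u| A x <= c |u| x. The vector x may vanish where the
    corresponding row of A does; this is what matrices diag(g) M with zeros in
    g require. *)
Lemma eigenvalue_modulus_le A x c z : 0 <= c -> (forall i j, 0 <= A i j) ->
  le_vec 0 x -> le_vec (A *m x) (c *: x) ->
  (forall i, x i 0 = 0 -> forall j, A i j = 0) ->
  eigenvalue (map_mx (real_complex R) A) z ->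
  ComplexField.Normc.normc z <= c.
Proof.
move=> c0 A0 x0 Axc Ax0 /eigenvalueP[u uA u0].
pose a j := ComplexField.Normc.normc (u 0 j).
have a0 j : 0 <= a j by exact: normc_ge0.
have zu j : z * u 0 j = \sum_i u 0 i * (A i j)%:C%C.
  have := congr1 (fun M : 'rV__ => M 0 j) uA; rewrite !mxE => <-.
  by apply: eq_bigr => i _; rewrite mxE.
have za j : ComplexField.Normc.normc z * a j <= \sum_i a i * A i j.
  rewrite -ComplexField.Normc.normcM zu (le_trans (normc_sum _))//.
  by apply: ler_sum => i _; rewrite ComplexField.Normc.normcM normc_real ger0_norm.
have x0' j : 0 <= x j 0 by have := x0 j; rewrite mxE.
have s0 : 0 <= \sum_j a j * x j 0 by apply: sumr_ge0 => j _; rewrite mulr_ge0.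
have := s0; rewrite le_eqVlt => /orP[/eqP s_eq0|s_gt0].
  (* here u vanishes on the support of x, where all nonzero rows of A lie *)
  have ax0 j : a j * x j 0 = 0.
    apply/eqP; rewrite eq_le mulr_ge0// andbT s_eq0 (bigD1 j)//= lerDl.
    by apply: sumr_ge0 => k _; rewrite mulr_ge0.
  have uA0 i j : u 0 i * (A i j)%:C%C = 0.
    have /eqP := ax0 i; rewrite mulf_eq0 => /orP[/eqP ui|/eqP xi].
      by rewrite (ComplexField.Normc.eq0_normc ui) mul0r.
    by rewrite Ax0// mulr0.
  have /existsP[j uj] : [exists j, u 0 j != 0].
    apply: contraNT u0 => /existsPn h; apply/eqP/rowP => j; rewrite mxE.
    by apply/eqP; have := h j; rewrite negbK.
  have /eqP := zu j; rewrite big1// mulf_eq0 (negbTE uj) orbF => /eqP ->.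
  by rewrite ComplexField.Normc.normc0.
rewrite -(ler_pM2r s_gt0) mulr_sumr.
apply: (@le_trans _ _ (\sum_j \sum_i (a i * A i j * x j 0))).
  by apply: ler_sum => j _; rewrite mulrA -mulr_suml ler_wpM2r.
rewrite exchange_big/= mulr_sumr; apply: ler_sum => i _.
under eq_bigr do rewrite -mulrA.
rewrite -mulr_sumr mulrCA ler_wpM2l//.
by have := Axc i; rewrite mulmx_cV mxE.
Qed.

Lemma spectral_radius_le A x c : 0 <= c -> (forall i j, 0 <= A i j) ->
  le_vec 0 x -> le_vec (A *m x) (c *: x) ->
  (forall i, x i 0 = 0 -> forall j, A i j = 0) ->
  spectral_radius A <= c.
Proof.
move=> c0 A0 x0 Axc Ax0; rewrite /spectral_radius.
set E := [set _ | _ in _].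
have [->|E0] := eqVneq E set0; first by rewrite sup0.
apply: ge_sup; first exact/set0P.
by move=> _ [z Az <-]; exact: (eigenvalue_modulus_le c0 A0 x0 Axc Ax0 Az).
Qed.

(** A strict inequality at finitely many indices leaves room for a smaller
    factor c - e. *)
Lemma spectral_radius_lt A x c : 0 < c -> (forall i j, 0 <= A i j) ->
  (forall i, 0 < x i 0) -> (forall i, (A *m x) i 0 < c * x i 0) ->
  spectral_radius A < c.
Proof.
move=> c0 A0 x0 Axc.
have slack_gt0 i : predT i -> 0 < c * x i 0 - (A *m x) i 0 by rewrite subr_gt0.
have [d d0 dx] := uniform_domination (fun i => x i 0) slack_gt0.
pose e := Num.min d c.
have ? : 0 < e by rewrite lt_min d0.
apply: (@le_lt_trans _ _ (c - e)); last by rewrite ltrBlDr ltrDl.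
apply: (@spectral_radius_le _ x) => //.
- by rewrite subr_ge0 ge_min lexx orbT.
- by move=> i; rewrite mxE ltW.
- move=> i; rewrite [leRHS]mxE mulrBl lerBrDr -lerBrDl.
  by rewrite (le_trans _ (dx i _))// ler_wpM2r ?(ltW (x0 i))// ge_min lexx.
- by move=> i xi; have := x0 i; rewrite xi ltxx.
Qed.

Lemma eigenvalue_le_spectral_radius A z : (forall i j, 0 <= A i j) ->
  eigenvalue (map_mx (real_complex R) A) z ->
  ComplexField.Normc.normc z <= spectral_radius A.
Proof.
move=> A0 Az; apply: ub_le_sup; last by exists z.
(* the largest row sum bounds all eigenvalues *)
pose e : 'cV[R]_n := const_mx 1.
have [d d0 dA] := @uniform_domination predT
  (fun i => (A *m e) i 0) (fun=> 1) (fun _ _ => ltr01).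
exists d^-1 => _ [z' Az' <-].
apply: (@eigenvalue_modulus_le A e) Az' => //.
- by rewrite invr_ge0 ltW.
- by move=> i; rewrite !mxE.
- move=> i; rewrite [leRHS]mxE [in leRHS]mxE mulr1 -[leRHS]mulr1.
  by rewrite mulrC ler_pdivlMr// mulrC dA.
- by move=> i /eqP; rewrite mxE oner_eq0.
Qed.

Lemma spectral_radius_ge0 A : 0 <= spectral_radius A.
Proof.
rewrite /spectral_radius; set E := [set _ | _ in _].
have [[[r Er] ubE]|/sup_out->//] := pselect (has_sup E).
apply: le_trans (ub_le_sup ubE Er).
by case: Er => z _ <-; exact: normc_ge0.
Qed.

Lemma det_neq0_above_spectral_radius A t : (forall i j, 0 <= A i j) ->
  spectral_radius A < t -> \det (t%:M - A) != 0.
Proof.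
move=> A0 At; apply/negP => /det0P[u u0 uA].
have : ComplexField.Normc.normc t%:C%C <= spectral_radius A.
  apply: eigenvalue_le_spectral_radius => //; apply/eigenvalueP.
  exists (map_mx (real_complex R) u); last by rewrite map_mx_eq0.
  rewrite -map_mxM -map_mxZ; congr map_mx; apply/eqP.
  by rewrite eq_sym -subr_eq0 -mul_mx_scalar -mulmxBr uA.
rewrite normc_real leNgt ger0_norm ?At//.
by rewrite (le_trans (spectral_radius_ge0 A))// ltW.
Qed.

(** Minimum principle: at the index i where y_i / x_i is smallest, a negative
    ratio m would give (A y)_i >= m (A x)_i > m c x_i = c y_i. *)
Lemma mmatrix_monotone A x c y : (forall i j, 0 <= A i j) ->
  (forall i, 0 < x i 0) -> (forall i, (A *m x) i 0 < c * x i 0) ->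
  le_vec 0 ((c%:M - A) *m y) -> le_vec 0 y.
Proof.
move=> A0 x0 Axc cAy i0; rewrite mxE leNgt; apply/negP => yi0.
pose i := [arg min_(i < i0) (y i 0 / x i 0)]%O.
have mini j : y i 0 / x i 0 <= y j 0 / x j 0.
  by rewrite /i; case: arg_minP => // k _; exact.
set m := y i 0 / x i 0 in mini.
have m0 : m < 0.
  apply: le_lt_trans (mini i0) _.
  by rewrite pmulr_llt0// invr_gt0.
have Ay : m * (A *m x) i 0 <= (A *m y) i 0.
  rewrite !mulmx_cV mulr_sumr; apply: ler_sum => j _.
  by rewrite mulrCA ler_wpM2l// -ler_pdivlMr.
have yi : y i 0 = m * x i 0 by rewrite /m divfK// gt_eqF.
have := cAy i; rewrite mulmxBl mul_scalar_mx !mxE subr_ge0 -!mulmx_cV.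
apply/negP; rewrite -ltNge (lt_le_trans _ Ay)// yi mulrCA.
by rewrite ltr_nM2l.
Qed.

(** A kernel vector and its opposite are both nonnegative by the minimum
    principle. *)
Lemma mmatrix_unit A x c : (forall i j, 0 <= A i j) ->
  (forall i, 0 < x i 0) -> (forall i, (A *m x) i 0 < c * x i 0) ->
  c%:M - A \in unitmx.
Proof.
move=> A0 x0 Axc; rewrite -unitmx_tr unitmxE unitfE.
apply/negP => /det0P[u u0 uA].
have cAu : (c%:M - A) *m u^T = 0.
  by apply: trmx_inj; rewrite trmx_mul trmxK uA trmx0.
case/eqP : u0; apply/rowP => j; rewrite mxE; apply/eqP; rewrite eq_le.
apply/andP; split.
  have := @mmatrix_monotone A x c (- u^T) A0 x0 Axc.
  rewrite mulmxN cAu oppr0 => /(_ (fun=> lexx _) j).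
  by rewrite !mxE oppr_ge0.
have := @mmatrix_monotone A x c u^T A0 x0 Axc.
rewrite cAu => /(_ (fun=> lexx _) j).
by rewrite !mxE.
Qed.

Lemma mmatrix_inv_ge0 A x c : (forall i j, 0 <= A i j) ->
  (forall i, 0 < x i 0) -> (forall i, (A *m x) i 0 < c * x i 0) ->
  forall i j, 0 <= invmx (c%:M - A) i j.
Proof.
move=> A0 x0 Axc i j.
have /(_ _ i) := @mmatrix_monotone A x c (col j (invmx (c%:M - A))) A0 x0 Axc.
rewrite colE mulmxA mulmxV ?mul1mx -?colE; last exact: mmatrix_unit Axc.
by rewrite !mxE; apply=> k; rewrite !mxE ler0n.
Qed.

Lemma horner_ge0_right (q : {poly R}) t :
  (forall s, t < s -> 0 <= q.[s]) -> 0 <= q.[t].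
Proof.
move=> qs; rewrite leNgt; apply/negP => qt.
have cq : horner q x @[x --> t^'+] --> q.[t].
  by apply: cvg_at_right_filter; exact: continuous_horner.
have : \forall s \near t^'+, t < s by exact: nbhs_right_gt.
move=> ts; have qs0 : \forall s \near t^'+, q.[s] < 0 by exact: cvgr_lt cq _ qt.
by have [s [/qs + ?]] := filter_ex (filterI ts qs0); rewrite leNgt => /negP.
Qed.

(** Makes the entries of the inverse of t - A, up to the positive factor
    det^2, a polynomial in t, so that their sign passes to the limit. *)
Lemma horner_adj_det A i j t :
  (\det (char_poly_mx A) * (\adj (char_poly_mx A)) i j).[t] =
  \det (t%:M - A) * (\adj (t%:M - A)) i j.
Proof.
have E : map_mx (horner_eval t) (char_poly_mx A) = t%:M - A.
  by apply/matrixP => k l; rewrite !mxE /horner_eval !hornerE hornerMn hornerX.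
by rewrite hornerM -E det_map_mx -map_mx_adj [X in _ = _ * X]mxE.
Qed.

(** The existence half of Perron-Frobenius, by contradiction: if c is not in
    the set T of admissible factors, then r = inf T >= c exceeds the spectral
    radius, r - A is invertible with nonnegative inverse, and
    x = (r - A)^-1 1 satisfies A x = r x - 1, which puts some r - e in T. *)
Lemma exists_strict_subinvariant A c : (forall i j, 0 <= A i j) ->
  spectral_radius A < c ->
  exists2 x : 'cV[R]_n, (forall i, 0 < x i 0) &
                        (forall i, (A *m x) i 0 < c * x i 0).
Proof.
move=> A0 Ac.
have c0 : 0 < c by exact: le_lt_trans (spectral_radius_ge0 A) Ac.
pose T := [set t | 0 < t /\ exists2 x : 'cV[R]_n, (forall i, 0 < x i 0) &
                                     (forall i, (A *m x) i 0 < t * x i 0)].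
have T_up s t : T s -> s <= t -> T t.
  move=> [s0 [x x0 Ax]] st; split; first exact: lt_le_trans st.
  by exists x => // i; rewrite (lt_le_trans (Ax i))// ler_wpM2r// ltW.
apply: contrapT => cT.
have Tc t : T t -> c < t.
  move=> Tt; rewrite ltNge; apply/negP => /(T_up _ _ Tt)[_].
  exact: cT.
have T_lb : has_lbound T by exists c => t /Tc /ltW.
pose one : 'cV[R]_n := const_mx 1.
have T0 : T !=set0.
  have [d d0 dA] := @uniform_domination predT
    (fun i => (A *m one) i 0) (fun=> 1) (fun _ _ => ltr01).
  exists (d^-1 + 1); split; first by rewrite addr_gt0// invr_gt0.
  exists one => i; first by rewrite mxE.
  rewrite [one i 0]mxE mulr1 (@le_lt_trans _ _ d^-1)// ?ltrDl//.
  by rewrite -[leRHS]mulr1 mulrC ler_pdivlMr// mulrC dA.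
pose r := inf T.
have cr : c <= r by apply: lb_le_inf => // t /Tc /ltW.
have r0 : 0 < r by exact: lt_le_trans cr.
have Tr t : r < t -> T t.
  by move=> /(inf_lt T0)[s Ts /ltW]; exact: T_up.
have det_r : \det (r%:M - A) != 0.
  by apply: det_neq0_above_spectral_radius => //; exact: lt_le_trans cr.
have unit_r : r%:M - A \in unitmx by rewrite unitmxE unitfE.
(* multiplying by det^2 > 0 keeps the sign and clears the denominator *)
have inv_adj t i j : t%:M - A \in unitmx ->
    invmx (t%:M - A) i j * \det (t%:M - A) ^+ 2 =
    \det (t%:M - A) * (\adj (t%:M - A)) i j.
  move=> U; rewrite /invmx U mxE expr2 mulrA mulrC [_^-1 * _]mulrC.
  by rewrite -mulrA mulVf ?mulr1// -unitfE -unitmxE.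
have N0 i j : 0 <= invmx (r%:M - A) i j.
  rewrite -(pmulr_lge0 _ (_ : 0 < \det (r%:M - A) ^+ 2)).
    rewrite inv_adj// -horner_adj_det; apply: horner_ge0_right => t rt.
    have [_ [x x0 Ax]] := Tr _ rt.
    rewrite horner_adj_det -inv_adj ?(mmatrix_unit A0 x0 Ax)//.
    by rewrite mulr_ge0 ?sqr_ge0// (mmatrix_inv_ge0 A0 x0 Ax).
  by rewrite lt_def sqrf_eq0 det_r sqr_ge0.
pose x := invmx (r%:M - A) *m one.
have rx i : r * x i 0 = (A *m x) i 0 + 1.
  have : ((r%:M - A) *m x) i 0 = 1 by rewrite mulmxA mulmxV// mul1mx mxE.
  rewrite mulmxBl mul_scalar_mx mxE [X in X + _]mxE [X in _ + X]mxE => <-.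
  by rewrite addrCA subrr addr0.
have x_ge0 : le_vec 0 x.
  move=> i; rewrite mxE mulmx_cV; apply: sumr_ge0 => j _.
  by rewrite mxE mulr1.
have Ax_ge0 i : 0 <= (A *m x) i 0.
  have := mulmx_monotone A0 x_ge0 i.
  by rewrite mulmx0 mxE.
have x_gt0 i : 0 < x i 0.
  by rewrite -(pmulr_rgt0 _ r0) rx ltr_wpDl.
have half_gt0 (i : 'I_n) : predT i -> 0 < 1 / 2 :> R by rewrite divr_gt0.
have [d d0 dx] := uniform_domination (fun i => x i 0) half_gt0.
pose e := Num.min d (r / 2).
have e0 : 0 < e by rewrite lt_min d0 divr_gt0.
have : T (r - e).
  split.
    rewrite subr_gt0 (@le_lt_trans _ _ (r / 2)) ?ge_min ?lexx ?orbT//.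
    by rewrite ltr_pdivrMr// ltr_pMr// ltr1n.
  exists x => // i; rewrite mulrBl rx -addrA ltrDl subr_gt0.
  rewrite (@le_lt_trans _ _ (1 / 2))//; last first.
    by rewrite ltr_pdivrMr// mul1r ltr1n.
  by rewrite (le_trans _ (dx i _))// ler_wpM2r ?(ltW (x_gt0 i))// ge_min lexx.
move=> /(ge_inf T_lb); apply/negP.
by rewrite -ltNge ltrBlDr ltrDl.
Qed.

(** Collatz-Wielandt lower bound: if rho(A) < c, then c - A has a nonnegative
    inverse, and (c - A) p <= 0 would force p <= 0. *)
Lemma le_spectral_radius A p c : (forall i j, 0 <= A i j) ->
  le_vec 0 p -> p != 0 -> le_vec (c *: p) (A *m p) -> c <= spectral_radius A.
Proof.
move=> A0 p0 pn0 cpA; rewrite leNgt; apply/negP => Ac.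
have [x x0 Ax] := exists_strict_subinvariant A0 Ac.
have /(mmatrix_monotone A0 x0 Ax) np : le_vec 0 ((c%:M - A) *m (- p)).
  move=> i; rewrite mulmxN mulmxBl mul_scalar_mx !mxE opprB subr_ge0.
  by have := cpA i; rewrite !mxE.
case/eqP : pn0; apply/colP => i; apply/eqP; rewrite mxE eq_le.
have := np i; have := p0 i.
by rewrite !mxE oppr_ge0 => -> ->.
Qed.

Lemma spectral_radius_scale_le A c : 0 < c -> (forall i j, 0 <= A i j) ->
  spectral_radius (c *: A) <= c * spectral_radius A.
Proof.
move=> c0 A0; apply/ler_addgt0Pr => e e0.
have : spectral_radius A < spectral_radius A + e / c.
  by rewrite ltrDl divr_gt0.
move=> /(exists_strict_subinvariant A0)[x x0 Ax].
apply/ltW/(@spectral_radius_lt _ x) => //.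
- by rewrite ltr_wpDl// mulr_ge0 ?spectral_radius_ge0 ?ltW.
- by move=> i j; rewrite mxE mulr_ge0// ltW.
- move=> i; rewrite -scalemxAl mxE.
  have -> : c * spectral_radius A + e = c * (spectral_radius A + e / c).
    by rewrite mulrDr mulrCA divff ?mulr1// gt_eqF.
  by rewrite -mulrA ltr_pM2l.
Qed.

End PerronFrobenius.

(** * Powers and signal-to-interference ratios *)

Section PowerControl.

Variables (R : realType) (L : nat) (F : 'M[R]_L) (v : 'cV[R]_L).
Hypothesis F_diag : forall i, F i i = 0.
Hypothesis F_offdiag : forall i j, i != j -> 0 < F i j.
Hypothesis v_gt0 : forall l, 0 < v l 0.
Implicit Types g p x pbar : 'cV[R]_L.

Let F_ge0 i j : 0 <= F i j.
Proof. by have [->|/F_offdiag/ltW//] := eqVneq i j; rewrite F_diag. Qed.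

Lemma le0_vecP x : le_vec 0 x <-> forall i, 0 <= x i 0.
Proof. by split=> x0 i; have := x0 i; rewrite mxE. Qed.

Lemma diag_mulE g m (M : 'M[R]_(L, m)) i j : (diag g *m M) i j = g i 0 * M i j.
Proof. by rewrite /diag mul_diag_mx !mxE. Qed.

Lemma diag_mul_ge0 g (M : 'M[R]_L) : le_vec 0 g ->
  (forall i j, 0 <= M i j) -> forall i j, 0 <= (diag g *m M) i j.
Proof. by move=> /le0_vecP g0 M0 i j; rewrite diag_mulE mulr_ge0. Qed.

Lemma interference_gt0 p i : le_vec 0 p -> 0 < (F *m p) i 0 + v i 0.
Proof.
by move=> p0; have := mulmx_monotone F_ge0 p0 i; rewrite mulmx0 mxE => /ltr_wpDl; exact.
Qed.

Lemma constraint_mx_ge0 pbar l i j : 0 < pbar l 0 ->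
  0 <= constraint_mx F v pbar l i j.
Proof.
move=> pbarl; rewrite !mxE addr_ge0// mulr_ge0 ?invr_ge0 ?(ltW pbarl)//.
by apply: sumr_ge0 => k _; rewrite !mxE mulr_ge0 ?ler0n// ?ord1 ltW.
Qed.

Lemma constraint_mulE g pbar l x i :
  (diag g *m constraint_mx F v pbar l *m x) i 0 =
  g i 0 * ((F *m x) i 0 + v i 0 * (x l 0 / pbar l 0)).
Proof.
rewrite -mulmxA diag_mulE mulmxDl mxE; congr (_ * (_ + _)).
rewrite -scalemxAl mxE -mulmxA mxE big_ord1 mulrC -mulrA; congr (_ * (_ * _)).
rewrite mxE (bigD1 l)//= big1 ?addr0 => [|j jl]; first by rewrite !mxE !eqxx mul1r.
by rewrite !mxE (negbTE jl) mul0r.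
Qed.

(** The defining equation gives diag(g) F p = p - diag(g) v, a strict decrease
    on the support of g; adding e to every entry of p makes the test vector
    positive, and a small e keeps the decrease there and creates it off the
    support, where the rows vanish. *)
Lemma Gamma_of_fixpoint g p : le_vec 0 g -> le_vec 0 p ->
  (forall i, p i 0 = g i 0 * ((F *m p) i 0 + v i 0)) -> Gamma_set F g.
Proof.
move=> g0 p0 pE; split=> //; have /le0_vecP g0' := g0; have /le0_vecP p0' := p0.
pose one : 'cV[R]_L := const_mx 1.
have gv i : 0 < g i 0 -> 0 < g i 0 * v i 0 by move=> ?; rewrite mulr_gt0.
have [e e0 eF] := uniform_domination (fun i => (diag g *m F *m one) i 0) gv.
apply: (@spectral_radius_lt _ _ _ (p + e *: one)) => //.
- exact: diag_mul_ge0.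
- by move=> i; rewrite !mxE mulr1 ltr_wpDl.
- move=> i; have -> : (diag g *m F *m (p + e *: one)) i 0 =
      g i 0 * (F *m p) i 0 + e * (diag g *m F *m one) i 0.
    by rewrite mulmxDr -scalemxAr mxE [X in _ + X]mxE -mulmxA diag_mulE.
  have -> : 1 * (p + e *: one) i 0 = p i 0 + e by rewrite !mxE mul1r mulr1.
  have [gi|gi] := ltP 0 (g i 0).
    apply: (@le_lt_trans _ _ (p i 0)); last by rewrite ltrDl.
    by rewrite [leRHS]pE mulrDr lerD2l eF.
  have gi0 : g i 0 = 0 by apply/le_anti; rewrite gi g0'.
  by rewrite -mulmxA diag_mulE gi0 !mul0r mulr0 addr0 ltr_wpDl.
Qed.

Lemma residualE g p i : ((1%:M - diag g *m F) *m p) i 0 =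
  p i 0 - g i 0 * (F *m p) i 0.
Proof.
rewrite mulmxBl mul1mx -mulmxA -(diag_mulE g (F *m p)).
by rewrite mxE [X in _ + X]mxE.
Qed.

Lemma power_fixpoint g : Gamma_set F g -> forall i,
  power F v g i 0 = g i 0 * ((F *m power F v g) i 0 + v i 0).
Proof.
move=> [g0 gF] i.
have [x x0 Ax] := exists_strict_subinvariant (diag_mul_ge0 g0 F_ge0) gF.
have U := mmatrix_unit (diag_mul_ge0 g0 F_ge0) x0 Ax.
have : (1%:M - diag g *m F) *m power F v g = diag g *m v.
  by rewrite mulmxA mulmxV// mul1mx.
move=> /(congr1 (fun M : 'cV_L => M i 0)).
rewrite residualE diag_mulE => /eqP.
by rewrite subr_eq addrC -mulrDr => /eqP.
Qed.

Lemma power_unique g p : Gamma_set F g ->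
  (forall i, p i 0 = g i 0 * ((F *m p) i 0 + v i 0)) -> power F v g = p.
Proof.
move=> [g0 gF] pE.
have [x x0 Ax] := exists_strict_subinvariant (diag_mul_ge0 g0 F_ge0) gF.
have U := mmatrix_unit (diag_mul_ge0 g0 F_ge0) x0 Ax.
rewrite /power; apply: canLR (mulKmx U) _.
apply/colP => i; rewrite residualE diag_mulE.
by rewrite {1}pE mulrDr addrC addKr.
Qed.

Lemma power_ge0 g : Gamma_set F g -> le_vec 0 (power F v g).
Proof.
move=> [g0 gF]; have /le0_vecP g0' := g0.
have [x x0 Ax] := exists_strict_subinvariant (diag_mul_ge0 g0 F_ge0) gF.
apply/le0_vecP => i; rewrite mulmx_cV; apply: sumr_ge0 => j _.
rewrite mulr_ge0 ?(mmatrix_inv_ge0 (diag_mul_ge0 g0 F_ge0) x0 Ax)//.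
by rewrite diag_mulE mulr_ge0// ltW.
Qed.

Lemma gamma_map_ge0 p : le_vec 0 p -> le_vec 0 (gamma_map F v p).
Proof.
move=> p0; apply/le0_vecP => i; rewrite mxE divr_ge0 ?(ltW (interference_gt0 _ _))//.
by have /le0_vecP := p0.
Qed.

Lemma gamma_map_fixpoint p i : le_vec 0 p ->
  p i 0 = gamma_map F v p i 0 * ((F *m p) i 0 + v i 0).
Proof. by move=> p0; rewrite mxE divfK// gt_eqF// interference_gt0. Qed.

Lemma gamma_map_Gamma p : le_vec 0 p -> Gamma_set F (gamma_map F v p).
Proof.
move=> p0; apply: (@Gamma_of_fixpoint _ p) => //; first exact: gamma_map_ge0.
by move=> i; exact: gamma_map_fixpoint.
Qed.

Lemma gamma_mapK p : le_vec 0 p -> power F v (gamma_map F v p) = p.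
Proof.
move=> p0; apply: power_unique; first exact: gamma_map_Gamma.
by move=> i; exact: gamma_map_fixpoint.
Qed.

Lemma powerK g : Gamma_set F g -> gamma_map F v (power F v g) = g.
Proof.
move=> gG; apply/colP => i; rewrite mxE power_fixpoint// mulfK// gt_eqF//.
by apply: interference_gt0; exact: power_ge0.
Qed.

(** * The spectral constraints describe the box of powers *)

Variable pbar : 'cV[R]_L.
Hypothesis pbar_gt0 : forall l, 0 < pbar l 0.

Lemma constraint_of_power_le g l : Gamma_set F g ->
  power F v g l 0 <= pbar l 0 ->
  spectral_radius (diag g *m constraint_mx F v pbar l) <= 1.
Proof.
move=> gG pl; have [/[dup] g0 /le0_vecP g0' _] := gG.
have p0 := power_ge0 gG.
apply: (@spectral_radius_le _ _ _ (power F v g)) => //.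
- by apply: diag_mul_ge0 => // i j; exact: constraint_mx_ge0.
- move=> i; rewrite scale1r constraint_mulE [leRHS]power_fixpoint//.
  by rewrite ler_wpM2l// lerD2l ger_pMr// ler_pdivrMr// mul1r.
- move=> i /eqP; rewrite power_fixpoint// mulf_eq0.
  rewrite (gt_eqF (interference_gt0 _ _))// orbF => /eqP gi j.
  by rewrite diag_mulE gi mul0r.
Qed.

(** Strict monotonicity of the spectral radius, made quantitative: the l-th
    row bounds x_i by k_i x_l uniformly in e, so that the rank one term
    outweighs the excess e x_i. *)
Lemma Gamma_of_constraint g l : le_vec 0 g -> 0 < g l 0 ->
  spectral_radius (diag g *m constraint_mx F v pbar l) <= 1 -> Gamma_set F g.
Proof.
move=> g0 gl B1; split; [exact: g0|have /le0_vecP g0' := g0].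
(* 2 bounds the factor 1 + e; as F l l = 0, only x_l <= x_l is left at i = l *)
pose k i := if i == l then 1 else 2 / (g l 0 * F l i).
have b_gt0 i : 0 < g i 0 -> 0 < g i 0 * (v i 0 / pbar l 0).
  by move=> gi; rewrite mulr_gt0// divr_gt0.
have [d d0 dk] := uniform_domination k b_gt0.
pose e := Num.min d 1.
have e0 : 0 < e by rewrite lt_min d0 ltr01.
have ed : e <= d by rewrite ge_min lexx.
have e1 : e <= 1 by rewrite ge_min lexx orbT.
have : spectral_radius (diag g *m constraint_mx F v pbar l) < 1 + e.
  by rewrite (le_lt_trans B1)// ltrDl.
have B0 : forall i j, 0 <= (diag g *m constraint_mx F v pbar l) i j.
  by apply: diag_mul_ge0 => // i j; exact: constraint_mx_ge0.
move=> /(exists_strict_subinvariant B0)[x x0 Bx].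
have xk i : x i 0 <= k i * x l 0.
  rewrite /k; case: eqVneq => [->|il]; first by rewrite mul1r.
  have Fli : 0 < g l 0 * F l i by rewrite mulr_gt0// F_offdiag// eq_sym.
  rewrite mulrAC ler_pdivlMr// mulrC.
  apply: (@le_trans _ _ ((1 + e) * x l 0)); last first.
    by rewrite ler_wpM2r ?(ltW (x0 l))//; lra.
  apply: le_trans (ltW (Bx l)); rewrite constraint_mulE -mulrA ler_wpM2l//.
  rewrite mulmx_cV (bigD1 i)//= -addrA lerDl addr_ge0//.
    by apply: sumr_ge0 => j _; rewrite mulr_ge0// ltW.
  by rewrite mulr_ge0 ?divr_ge0 ?ltW.
apply: (@spectral_radius_lt _ _ _ x) => //; first exact: diag_mul_ge0.
move=> i; rewrite -mulmxA diag_mulE mul1r.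
have [gi|] := ltP 0 (g i 0); last first.
  by move=> gi; rewrite (le_lt_trans _ (x0 i))// (_ : g i 0 = 0) ?mul0r//;
    apply/le_anti; rewrite gi g0'.
have := Bx i; rewrite constraint_mulE mulrDr -ltrBrDr => /lt_le_trans; apply.
rewrite mulrDl mul1r -addrA gerDl subr_le0.
apply: (@le_trans _ _ (d * (k i * x l 0))).
  by rewrite ler_pM// ltW.
rewrite [leLHS]mulrA; apply: (le_trans (ler_wpM2r (ltW (x0 l)) (dk i gi))).
by rewrite le_eqVlt; apply/orP; left; apply/eqP; ring.
Qed.

(** If p_l exceeded pbar_l, the vector p = P(g) would satisfy
    B_l p >= (1 + e) p, against the Collatz-Wielandt bound. *)
Lemma power_le_of_constraint g l : Gamma_set F g ->
  spectral_radius (diag g *m constraint_mx F v pbar l) <= 1 ->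
  power F v g l 0 <= pbar l 0.
Proof.
move=> gG B1; have [/[dup] g0 /le0_vecP g0' _] := gG.
set p := power F v g; have p0 : le_vec 0 p by exact: power_ge0.
rewrite leNgt; apply/negP => pl.
pose h := p l 0 / pbar l 0 - 1.
have h0 : 0 < h by rewrite subr_gt0 ltr_pdivlMr// mul1r.
have b_gt0 i : 0 < g i 0 -> 0 < g i 0 * v i 0 * h.
  by move=> gi; rewrite !mulr_gt0.
have [e e0 ep] := uniform_domination (fun i => p i 0) b_gt0.
have : 1 + e <= spectral_radius (diag g *m constraint_mx F v pbar l).
  apply: (@le_spectral_radius _ _ _ p) => //.
  - by apply: diag_mul_ge0 => // i j; exact: constraint_mx_ge0.
  - apply/eqP => p_eq0; have := lt_trans (pbar_gt0 l) pl.
    by rewrite p_eq0 mxE ltxx.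
  - move=> i; rewrite mxE constraint_mulE.
    have -> : p l 0 / pbar l 0 = 1 + h by rewrite /h addrC subrK.
    rewrite [v i 0 * _]mulrDr mulr1 addrA [leRHS]mulrDr -power_fixpoint//.
    rewrite mulrDl mul1r lerD2l mulrA.
    have [gi|gi] := ltP 0 (g i 0); first exact: ep.
    have gi0 : g i 0 = 0 by apply/le_anti; rewrite gi g0'.
    by rewrite /p power_fixpoint// gi0 !mul0r mulr0.
by move=> /le_trans/(_ B1); rewrite gerDl leNgt e0.
Qed.

(** A constraint yields membership in Gamma only at an index with g_l > 0; for
    g = 0 every constraint matrix vanishes and the fixed point p = 0 serves. *)
Lemma feasible_IIP g : le_vec 0 g ->
  feasible_II F v pbar g <-> Gamma_set F g /\ feasible_I pbar (power F v g).
Proof.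
move=> g0; have /le0_vecP g0' := g0; split=> [[_ gB]|[gG [_ gp]]]; last first.
  by split=> // l; exact: constraint_of_power_le.
have gG : Gamma_set F g.
  have [/existsP[l gl]|/existsPn gle0] := boolP [exists l, 0 < g l 0].
    exact: Gamma_of_constraint (gB l).
  apply: (@Gamma_of_fixpoint g 0) => // i.
  have -> : g i 0 = 0 by apply/le_anti; rewrite g0' andbT leNgt gle0.
  by rewrite mxE mul0r.
split=> //; split; first exact: power_ge0.
by move=> l; exact: power_le_of_constraint.
Qed.

Lemma feasible_II_gamma_map p :
  feasible_I pbar p -> feasible_II F v pbar (gamma_map F v p).
Proof.
move=> pf; have [p0 _] := pf; apply/feasible_IIP; first exact: gamma_map_ge0.
by rewrite gamma_mapK//; split=> //; exact: gamma_map_Gamma.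
Qed.

Lemma maximal_solutionP w g : le_vec 0 g ->
  maximal_solution (feasible_II F v pbar) (sum_rate w) g <->
  Gamma_set F g /\
  maximal_solution (feasible_I pbar) (objective_I F v w) (power F v g).
Proof.
move=> g0; rewrite /maximal_solution /objective_I; split.
  move=> [/feasible_IIP[//|gG gI] gmax]; split=> //; split=> // p pI.
  by rewrite powerK//; apply: gmax; exact: feasible_II_gamma_map.
move=> [gG [gI gmax]]; split; first exact/feasible_IIP.
move=> h hII; have [h0 _] := hII.
move: hII => /feasible_IIP[//|hG /gmax].
by rewrite !powerK.
Qed.

Lemma objective_I_image w :
  objective_I F v w @` feasible_I pbar = sum_rate w @` feasible_II F v pbar.
Proof.
apply/seteqP; split=> [_ [p pI <-]|_ [g gII <-]].
  by exists (gamma_map F v p) => //; exact: feasible_II_gamma_map.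
have [g0 _] := gII; move: gII => /feasible_IIP[//|gG gI].
by exists (power F v g) => //; rewrite /objective_I powerK.
Qed.

(** * Maximisers *)

Lemma le_vec_pbar0 : le_vec 0 pbar.
Proof. by apply/le0_vecP => i; exact: ltW. Qed.

Lemma gamma_map_pbar_gt0 i : 0 < gamma_map F v pbar i 0.
Proof. by rewrite mxE divr_gt0// interference_gt0//; exact: le_vec_pbar0. Qed.

Lemma sum_rate_scale_lt w g c l : prob_vec w -> le_vec 0 g -> 1 < c ->
  0 < w l 0 -> 0 < g l 0 -> sum_rate w g < sum_rate w (c *: g).
Proof.
move=> [/le0_vecP w0 _] /le0_vecP g0 c1 wl gl.
have c0 : 0 < c by exact: lt_trans c1.
have pos i : 0 < 1 + g i 0 by rewrite ltr_pwDl.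
have posc i : 0 < 1 + (c *: g) i 0 by rewrite mxE ltr_pwDl// mulr_ge0// ltW.
rewrite /sum_rate (bigD1 l)//= [ltRHS](bigD1 l)//= ltr_leD//.
  by rewrite ltr_pM2l// ltr_ln ?posrE// mxE ltrD2l ltr_pMl.
apply: ler_sum => i _; rewrite ler_wpM2l// ler_ln ?posrE// mxE lerD2l.
by rewrite ler_peMl// ltW.
Qed.

(** The ratios at full power are all positive, so the maximum is positive and
    cannot be attained where g vanishes on the support of w. *)
Lemma maximal_solution_gt0 w g : prob_vec w ->
  maximal_solution (feasible_II F v pbar) (sum_rate w) g ->
  exists2 l, 0 < w l 0 & 0 < g l 0.
Proof.
move=> [/le0_vecP w0 w1] [[/le0_vecP g0 _] gmax].
have pf : feasible_I pbar pbar by split=> //; exact: le_vec_pbar0.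
have rate_pbar : 0 < sum_rate w (gamma_map F v pbar).
  have rate_ge0 i : 0 <= w i 0 * ln (1 + gamma_map F v pbar i 0).
    by rewrite mulr_ge0// ln_ge0// lerDl ltW// gamma_map_pbar_gt0.
  have [l wl] : exists l, 0 < w l 0.
    apply: contrapT => /forallNP wn; have : \sum_l w l 0 = 0.
      apply: big1 => l _; apply/le_anti; rewrite w0 andbT leNgt.
      exact/negP/wn.
    by rewrite w1 => /eqP; rewrite oner_eq0.
  rewrite /sum_rate (bigD1 l)//= ltr_pwDl ?sumr_ge0//.
  by rewrite mulr_gt0// ln_gt0// ltrDl gamma_map_pbar_gt0.
have := lt_le_trans rate_pbar (gmax _ (feasible_II_gamma_map pf)).
apply: contraPP => /forall2NP wg; apply/negP; rewrite -leNgt /sum_rate big1// => l _.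
have [wl|gl] := wg l.
  have -> : w l 0 = 0 by apply/le_anti; rewrite w0 andbT leNgt; exact/negP.
  by rewrite mul0r.
have -> : g l 0 = 0 by apply/le_anti; rewrite g0 andbT leNgt; exact/negP.
by rewrite addr0 ln1 mulr0.
Qed.

(** The spectral radius is homogeneous: if all constraints are slack, a
    multiple (1 + d) g with d > 0 is still feasible and does better. *)
Lemma maximal_solution_boundary w g : prob_vec w ->
  maximal_solution (feasible_II F v pbar) (sum_rate w) g ->
  exists l, spectral_radius (diag g *m constraint_mx F v pbar l) = 1.
Proof.
move=> wP gM; have [k wk gk] := maximal_solution_gt0 wP gM.
case: gM => [[g0 gB] gmax]; apply: contrapT => /forallNP gB1.
pose rho l := spectral_radius (diag g *m constraint_mx F v pbar l).
have rho_lt1 l : predT l -> 0 < 1 - rho l.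
  by rewrite subr_gt0 lt_neqAle gB andbT => _; exact/eqP/gB1.
have [d d0 dr] := uniform_domination rho rho_lt1.
have d1 : 1 < 1 + d by rewrite ltrDl.
have d1_gt0 : 0 < 1 + d by exact: lt_trans d1.
have : feasible_II F v pbar ((1 + d) *: g).
  split=> [|l].
    apply/le0_vecP => i; rewrite mxE mulr_ge0 ?(ltW d1_gt0)//.
    by have /le0_vecP := g0.
  have -> : diag ((1 + d) *: g) *m constraint_mx F v pbar l =
      (1 + d) *: (diag g *m constraint_mx F v pbar l).
    by apply/matrixP => i j; rewrite [RHS]mxE !diag_mulE mxE mulrA.
  rewrite (le_trans (spectral_radius_scale_le d1_gt0 _))//.
    by apply: diag_mul_ge0 => // i j; exact: constraint_mx_ge0.
  by rewrite mulrDl mul1r -lerBrDl dr.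
move=> /gmax; rewrite leNgt => /negP; apply.
exact: sum_rate_scale_lt wP g0 d1 wk gk.
Qed.

Lemma objective_I_max w : exists p,
  maximal_solution (feasible_I pbar) (objective_I F v w) p.
Proof.
pose box := [set q : 'rV[R]_L | forall i, `[0, pbar i 0]%classic (q ord0 i)].
have boxP q : box q <-> feasible_I pbar q^T.
  split=> [qb|[/le0_vecP q0 qp] i].
    by split=> [|i]; [apply/le0_vecP => i|];
      rewrite mxE; have := qb i; rewrite /= in_itv/= => /andP[].
  by have := q0 i; have := qp i; rewrite /= mxE in_itv/= => -> ->.
have box_compact : compact box.
  by apply: (@rV_compact R L (fun i => `[0, pbar i 0]%classic)) => i;
    exact: segment_compact.
have box0 : box !=set0.
  by exists 0 => i; rewrite mxE /= in_itv/= lexx ltW.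
have cont : {within box, continuous (fun q : 'rV[R]_L => objective_I F v w q^T)}.
  apply: continuous_in_subspaceT => q /set_mem /boxP [q0 _].
  have sum_cont (I : finType) (f : I -> 'rV[R]_L -> R) :
      (forall i, f i u @[u --> q] --> f i q) ->
      \sum_i f i u @[u --> q] --> \sum_i f i q.
    move=> fq; apply: (@cvg_big R I +%R 0 predT _ _ (nbhs q)) => [|i _].
    - exact: add_continuous.
    - exact: fq.
  apply: (sum_cont _ (fun l u => w l 0 * ln (1 + gamma_map F v u^T l 0))) => l.
  have gl0 : 0 <= gamma_map F v q^T l 0 by have /le0_vecP := gamma_map_ge0 q0.
  pose I (u : 'rV[R]_L) := \sum_j F l j * u ord0 j + v l 0.
  have gE : (fun u : 'rV[R]_L => gamma_map F v u^T l 0) = (fun u => u ord0 l * (I u)^-1).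
    apply/funext => u; rewrite mxE mulmx_cV mxE.
    by under eq_bigr do rewrite mxE.
  have Icvg : I u @[u --> q] --> I q.
    have Scvg := @sum_cont _ (fun j u => F l j * u ord0 j).
    apply: (cvgD (Scvg _) (cvg_cst (v l 0))) => j.
    exact: (cvgMl_tmp (@coord_continuous _ _ _ ord0 j q)).
  have Iq : I q != 0.
    have := interference_gt0 l q0; rewrite mulmx_cV => /gt_eqF.
    by under eq_bigr do rewrite mxE; rewrite /I => ->.
  have gcvg : gamma_map F v u^T l 0 @[u --> q] --> gamma_map F v q^T l 0.
    rewrite gE (congr1 (@^~ q) gE).
    exact: (cvgM (@coord_continuous _ _ _ ord0 l q) (cvgV Iq Icvg)).
  have gl : 1 + gamma_map F v u^T l 0 @[u --> q] --> 1 + gamma_map F v q^T l 0.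
    exact: (cvgD (cvg_cst (1 : R)) gcvg).
  have ln_cont : {for 1 + gamma_map F v q^T l 0, continuous (@ln R)}.
    by apply: continuous_ln; rewrite ltr_pwDl.
  have ln_cvg : ln (1 + gamma_map F v u^T l 0) @[u --> q] -->
      ln (1 + gamma_map F v q^T l 0) by exact: (continuous_cvg _ ln_cont gl).
  exact: (cvgMl_tmp ln_cvg).
have [q /set_mem/boxP qI qmax] := compact_EVT_max box0 box_compact cont.
exists q^T; split=> // p pI; rewrite -(trmxK p); apply: qmax; apply/mem_set/boxP.
by rewrite trmxK.
Qed.

End PowerControl.

(** * Equivalence of the two problems *)

Theorem theorem3p2 (R : realType) (L : nat) (F : 'M[R]_L)
    (v w pbar : 'cV[R]_L)
    (F_diag : forall i, F i i = 0)
    (F_offdiag : forall i j, i != j -> 0 < F i j)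
    (v_gt0 : forall l, 0 < v l 0)
    (w_prob : prob_vec w)
    (pbar_gt0 : forall l, 0 < pbar l 0) :
  [/\ exists M : R,
        is_max (objective_I F v w @` feasible_I pbar) M /\
        is_max (sum_rate w @` feasible_II F v pbar) M,
      forall g : 'cV[R]_L, le_vec 0 g ->
        (maximal_solution (feasible_II F v pbar) (sum_rate w) g <->
         Gamma_set F g /\
         maximal_solution (feasible_I pbar) (objective_I F v w) (power F v g))
    & forall g : 'cV[R]_L,
        maximal_solution (feasible_II F v pbar) (sum_rate w) g ->
        exists l, spectral_radius (diag g *m constraint_mx F v pbar l) = 1].
Proof.
split.
- have [p [pI pmax]] := objective_I_max F_diag F_offdiag v_gt0 pbar_gt0 w.
  have pM : is_max (objective_I F v w @` feasible_I pbar) (objective_I F v w p).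
    by split; [exists p|move=> _ [q qI <-]; exact: pmax].
  exists (objective_I F v w p); split=> //.
  by rewrite -(objective_I_image F_diag F_offdiag v_gt0 pbar_gt0).
- by move=> g; exact: maximal_solutionP.
- by move=> g; exact: maximal_solution_boundary.
Qed.
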